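(* Let $N_1,N_2\ge 0$ and let $(u(r),v(r))$ be an entire radial solution of the system $$\begin{cases}\Delta u=-2e^u+e^v+4e^{2u}-2e^{2v}-e^{u+v}+4\pi N_1\delta_0\\ \Delta v=e^u-2e^v-2e^{2u}+4e^{2v}-e^{u+v}+4\pi N_2\delta_0\end{cases}\quad\text{in }\mathbb{R}^2.$$ Then $u(r)<0$ and $v(r)<0$ for all $r\in(0,\infty)$, unless $u(r)=v(r)=0$ for all $r\in(0,\infty)$.
   Context: Here $\delta_0$ is the Dirac measure at the origin of $\mathbb{R}^2$ and $r=|x|$. An entire radial solution is a pair of functions $u(r),v(r)$ defined for all $r\in(0,\infty)$, satisfying the system away from the origin, i.e. $u_{rr}+\frac1r u_r=-2e^u+e^v+4e^{2u}-2e^{2v}-e^{u+v}$ and $v_{rr}+\frac1r v_r=e^u-2e^v-2e^{2u}+4e^{2v}-e^{u+v}$ on $(0,\infty)$, and satisfying $u(r)=2N_1\log r+O(1)$, $v(r)=2N_2\log r+O(1)$ as $r\to0^+$ (with Dirac masses $4\pi N_1$, $4\pi N_2$ at the origin, so that $ru_r\to 2N_1$ and $rv_r\to 2N_2$ as $r\to 0^+$). *)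

(* Defs.v *)
(* Stdlib reals with Coquelicot. *)
From Stdlib Require Import Reals.
From Coquelicot Require Import Coquelicot.

Open Scope R_scope.

(* Radial functions are represented by profiles R -> R of which only the values
   on (0, +oo) matter. *)

(* [Derive] is total, so twice differentiability is required separately. *)
Definition twice_derivable (f : R -> R) (r : R) : Prop :=
  ex_derive f r /\ ex_derive (Derive f) r.

Definition radial_laplacian (f : R -> R) (r : R) : R :=
  Derive (Derive f) r + / r * Derive f r.

(* f(r) = c log r + O(1) as r -> 0+ *)
Definition log_asymp_at_0 (f : R -> R) (c : R) : Prop :=
  exists C : R, at_right 0 (fun r => Rabs (f r - c * ln r) <= C).

(* The flux condition r f'(r) -> 2 N (strength 4 pi N on small circles divided
   by 2 pi) is the radial form of the source term 4 pi N delta_0. *)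
Definition radial_source_at_0 (f : R -> R) (N : R) : Prop :=
  log_asymp_at_0 f (2 * N) /\
  filterlim (fun r => r * Derive f r) (at_right 0) (locally (2 * N)).

Definition entire_radial_solution (N1 N2 : R) (u v : R -> R) : Prop :=
  (forall r : R, 0 < r ->
     twice_derivable u r /\ twice_derivable v r /\
     radial_laplacian u r =
       - 2 * exp (u r) + exp (v r) + 4 * exp (2 * u r) - 2 * exp (2 * v r)
       - exp (u r + v r) /\
     radial_laplacian v r =
       exp (u r) - 2 * exp (v r) - 2 * exp (2 * u r) + 4 * exp (2 * v r)
       - exp (u r + v r)) /\
  radial_source_at_0 u N1 /\ radial_source_at_0 v N2.

(* Main.v *)
Require Import Defs.
From Stdlib Require Import Reals Lra Classical.
From Coquelicot Require Import Coquelicot.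

Open Scope R_scope.

(** Write [F u v] for the right-hand side of the first equation; by symmetry
    the second one is [F v u]. Where [u >= v] and [u > 0] one has
    [F u v >= e^(2u) - e^u >= u^2 + u], so [max(u, v)] is a subsolution of an
    equation of Keller-Osserman type on its positivity set. Comparing it, on
    balls of radius [B], with the barrier [24 B^2 / (B^2 - r^2)^2 + eps ln (B/r)],
    which is infinite at both ends, and letting [eps -> 0] and then
    [B -> oo], gives [u, v <= 0]. If one of the functions vanishes at some
    point, it has a maximum there, and the equation forces the other to vanish
    as well; then both functions and their derivatives vanish at that point,
    and uniqueness for the ODE gives [u = v = 0]. *)

(** * The nonlinearity and its bounds *)

Definition F (x y : R) : R :=
  - 2 * exp x + exp y + 4 * exp (2 * x) - 2 * exp (2 * y) - exp (x + y).

(** A single equation: the system is [solves u v] together with [solves v u], so each lemma serves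
    both components by swapping. *)
Definition solves (u v : R -> R) : Prop :=
  forall r, 0 < r -> twice_derivable u r /\ radial_laplacian u r = F (u r) (v r).

Lemma exp_double (x : R) : exp (2 * x) = exp x * exp x.
Proof. rewrite <- exp_plus; f_equal; ring. Qed.

Lemma exp_ge_1_plus (x : R) : 1 + x <= exp x.
Proof.
  destruct (Req_dec x 0) as [-> | hx]; [rewrite exp_0; lra|].
  left; now apply exp_ineq1.
Qed.

(** With [U = exp x] and [V = exp y], the excess of [F x y] over [U * (U - 1)] factors as
    [(U - V) * (3 * U + 2 * V - 1)]. *)
Lemma F_ge_quadratic (x y : R) : 0 < x -> y <= x -> x * x + x <= F x y.
Proof.
  intros hx hyx; unfold F.
  rewrite !exp_double, exp_plus.
  assert (hU := exp_ge_1_plus x).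
  assert (hV := exp_pos y).
  assert (hVU : exp y <= exp x) by
    (destruct hyx as [h | ->]; [left; now apply exp_increasing | lra]).
  assert (0 <= (exp x - exp y) * (3 * exp x + 2 * exp y - 1)) by
    (apply Rmult_le_pos; lra).
  assert ((1 + x) * x <= exp x * (exp x - 1)) by
    (apply Rmult_le_compat; lra).
  nra.
Qed.

Lemma F_Lipschitz_nonpos (x y : R) :
  x <= 0 -> y <= 0 -> Rabs (F x y) <= 6 * (Rabs x + Rabs y).
Proof.
  intros hx hy; unfold F.
  rewrite !exp_double, exp_plus.
  assert (hU := exp_ge_1_plus x); assert (hV := exp_ge_1_plus y).
  assert (hU0 := exp_pos x); assert (hV0 := exp_pos y).
  assert (hU1 : exp x <= 1) by
    (rewrite <- exp_0; destruct hx as [h | ->]; [left; now apply exp_increasing | lra]).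
  assert (hV1 : exp y <= 1) by
    (rewrite <- exp_0; destruct hy as [h | ->]; [left; now apply exp_increasing | lra]).
  rewrite (Rabs_left1 x hx), (Rabs_left1 y hy).
  set (U := exp x) in *; set (V := exp y) in *.
  (* [F] vanishes at the origin, so it splits along [1 - U <= -x] and [1 - V <= -y], with
     coefficients at most 6 in absolute value. *)
  replace (-2 * U + V + 4 * (U * U) - 2 * (V * V) - U * V)
    with ((V + 1) * 2 * (1 - V) - (1 - U) * (4 * U + 2 - V)) by ring.
  apply Rabs_le; split; nra.
Qed.

(** * The maximum principle at an interior maximum *)

(** If [l > 0], then [f1] is positive just to the right of its zero [p], and the mean value theorem
    makes [f] exceed [f p] there. *)
Lemma derivatives_at_max (f f1 : R -> R) (a b p l : R) :
  a < p < b -> (forall x, a < x < b -> is_derive f x (f1 x)) ->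
  is_derive f1 p l -> (forall x, a < x < b -> f x <= f p) ->
  f1 p = 0 /\ l <= 0.
Proof.
  intros hp hf hl hmax.
  assert (h0 : f1 p = 0).
  { assert (hd : derivable_pt_lim f p (f1 p)) by (apply is_derive_Reals; auto).
    exact (deriv_maximum f a b p (exist _ _ hd)
      (proj1 hp) (proj2 hp) (fun x h1 h2 => hmax x (conj h1 h2))). }
  split; [exact h0|].
  destruct (Rle_or_lt l 0) as [h | hpos]; [exact h | exfalso].
  apply is_derive_Reals in hl.
  destruct (hl (l / 2)) as [d hd]; [lra|].
  assert (hd0 := cond_pos d).
  set (y := Rmin (p + d / 2) ((p + b) / 2)).
  assert (hy : p < y) by (apply Rmin_glb_lt; lra).
  assert (hy1 : y <= p + d / 2) by apply Rmin_l.
  assert (hy2 : y <= (p + b) / 2) by apply Rmin_r.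
  destruct (MVT_cor2 f f1 p y hy) as [c [he hc]].
  { intros x hx; apply is_derive_Reals, hf; lra. }
  assert (hyp : f y <= f p) by (apply hmax; lra).
  specialize (hd (c - p) ltac:(lra)).
  rewrite Rabs_right in hd by lra.
  specialize (hd ltac:(lra)).
  replace (p + (c - p)) with c in hd by ring.
  rewrite h0 in hd.
  apply Rabs_def2 in hd.
  assert (hq : 0 < (f1 c - 0) / (c - p)) by lra.
  assert (hfc : 0 < f1 c).
  { replace (f1 c) with ((f1 c - 0) / (c - p) * (c - p)) by (field; lra).
    apply Rmult_lt_0_compat; lra. }
  assert (0 < f1 c * (y - p)) by (apply Rmult_lt_0_compat; lra).
  lra.
Qed.

(** The test function [psi] will be the barrier in the comparison argument, and the constant 0 at a
    zero of a solution. *)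
Lemma laplacian_at_max (f : R -> R) (psi psi1 : R -> R) (a b p l : R) :
  a < p < b ->
  (forall x, a < x < b -> twice_derivable f x) ->
  (forall x, a < x < b -> is_derive psi x (psi1 x)) -> is_derive psi1 p l ->
  (forall x, a < x < b -> f x - psi x <= f p - psi p) ->
  Derive f p = psi1 p /\ radial_laplacian f p <= l + / p * psi1 p.
Proof.
  intros hp hf hpsi hl hmax.
  destruct (derivatives_at_max (fun x => f x - psi x)
    (fun x => Derive f x - psi1 x) a b p (Derive (Derive f) p - l)) as [h1 h2]; auto.
  - intros x hx; apply (is_derive_minus f psi); [|auto].
    apply Derive_correct, (hf x hx).
  - apply (is_derive_minus (Derive f) psi1); [|auto].
    apply Derive_correct, (hf p hp).
  - split; [lra|]. unfold radial_laplacian.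
    replace (Derive f p) with (psi1 p) by lra. lra.
Qed.

(** * The barrier and its Laplacian *)

Definition barrier (B eps r : R) : R :=
  24 * (B * B) / ((B * B - r * r) * (B * B - r * r)) + eps * (ln B - ln r).

Definition barrier1 (B eps r : R) : R :=
  96 * (B * B) * r / ((B * B - r * r) ^ 3) - eps / r.

Lemma is_derive_barrier (B eps r : R) :
  0 < r < B -> is_derive (barrier B eps) r (barrier1 B eps r).
Proof.
  intros hr; unfold barrier, barrier1.
  assert (0 < B * B - r * r) by nra.
  auto_derive.
  - repeat split; try lra; apply Rgt_not_eq; nra.
  - field; split; lra.
Qed.

Lemma is_derive_barrier1 (B eps r : R) :
  0 < r < B ->
  is_derive (barrier1 B eps) r
    (96 * (B * B) / ((B * B - r * r) ^ 3)
     + 576 * (B * B) * (r * r) / ((B * B - r * r) ^ 4) + eps / (r * r)).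
Proof.
  intros hr; unfold barrier1.
  assert (0 < B * B - r * r) by nra.
  auto_derive.
  - repeat split; try lra.
    apply Rgt_not_eq; repeat apply Rmult_lt_0_compat; lra.
  - field; split; lra.
Qed.

(* The logarithmic term is harmonic, and [24] is the constant for which the
   other term [phi] satisfies [Delta phi <= phi^2]. *)
Lemma barrier_laplacian_le (B eps r : R) :
  0 < r < B ->
  (96 * (B * B) / ((B * B - r * r) ^ 3)
     + 576 * (B * B) * (r * r) / ((B * B - r * r) ^ 4) + eps / (r * r))
  + / r * barrier1 B eps r
  <= (24 * (B * B) / ((B * B - r * r) * (B * B - r * r))) ^ 2.
Proof.
  intros hr; unfold barrier1.
  assert (hs : 0 < B * B - r * r) by nra.
  assert (h4 : 0 < / ((B * B - r * r) ^ 4)) by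
    (apply Rinv_0_lt_compat, pow_lt, hs).
  (* With [s = B * B - r * r], the choice [24 ^ 2 = 576] merges the [s ^ 4] terms into
     [576 * (B * B) / s ^ 3], against [192 * (B * B) / s ^ 3] on the left. *)
  match goal with |- ?a <= ?b =>
    assert (he : b - a = 384 * (B * B) * (B * B - r * r) * / ((B * B - r * r) ^ 4)) by
      (field; split; lra) end.
  assert (0 <= 384 * (B * B) * (B * B - r * r) * / ((B * B - r * r) ^ 4)) by
    (apply Rmult_le_pos; [apply Rmult_le_pos; nra | lra]).
  lra.
Qed.

Lemma barrier_gt_main (B eps r : R) :
  0 < r < B -> 0 < eps ->
  0 < 24 * (B * B) / ((B * B - r * r) * (B * B - r * r)) < barrier B eps r.
Proof.
  intros hr he; unfold barrier.
  assert (hs : 0 < B * B - r * r) by nra.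
  assert (ln r < ln B) by (apply ln_increasing; lra).
  split; [apply Rdiv_lt_0_compat; nra | nra].
Qed.

(** * Comparison of solutions with the barrier *)

(** Otherwise [u p] exceeds the main term [phi] of the barrier, so the Laplacian of [u] at [p]
    exceeds [phi ^ 2], hence that of the barrier, against the maximum principle. *)
Lemma no_contact_above_barrier (u v : R -> R) (B eps a b p : R) :
  solves u v -> 0 < eps -> 0 < a -> b < B -> a < p < b ->
  (forall x, a <= x <= b -> u x - barrier B eps x <= u p - barrier B eps p) ->
  v p <= u p -> u p <= barrier B eps p.
Proof.
  intros hs he ha hb hp hmax hvu.
  destruct (Rle_or_lt (u p) (barrier B eps p)) as [h | hgt]; [exact h | exfalso].
  assert (hpB : 0 < p < B) by lra.
  destruct (laplacian_at_max u (barrier B eps) (barrier1 B eps) a b p _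
    hp
    (fun x hx => proj1 (hs x ltac:(lra)))
    (fun x hx => is_derive_barrier B eps x ltac:(lra))
    (is_derive_barrier1 B eps p hpB)
    (fun x hx => hmax x ltac:(lra))) as [_ hlap].
  assert (hle := barrier_laplacian_le B eps p hpB).
  destruct (barrier_gt_main B eps p hpB he) as [h0 h1].
  rewrite (proj2 (hs p (proj1 hpB))) in hlap.
  assert (hq := F_ge_quadratic (u p) (v p) ltac:(lra) hvu).
  set (phi := 24 * (B * B) / ((B * B - p * p) * (B * B - p * p))) in *.
  assert (phi ^ 2 < u p * u p) by nra.
  lra.
Qed.

Lemma solves_continuous (u v : R -> R) (r : R) :
  solves u v -> 0 < r -> continuity_pt u r.
Proof.
  intros hs hr; apply continuity_pt_filterlim.
  apply (ex_derive_continuous u), (hs r hr).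
Qed.

Lemma exists_max_diff_barrier (u v : R -> R) (B eps a b : R) :
  solves u v -> 0 < a <= b -> b < B ->
  exists p, a <= p <= b /\
    forall x, a <= x <= b -> u x - barrier B eps x <= u p - barrier B eps p.
Proof.
  intros hs hab hb.
  destruct (continuity_ab_maj (fun x => u x - barrier B eps x) a b) as [p [h1 h2]].
  - lra.
  - intros x hx; apply continuity_pt_minus.
    + apply (solves_continuous u v); [assumption | lra].
    + apply continuity_pt_filterlim, (ex_derive_continuous (barrier B eps)).
      eexists; apply is_derive_barrier; lra.
  - exists p; auto.
Qed.

(** As [N >= 0], the singularity can only push [u] down: [u] is bounded above near 0, while the
    logarithm in the barrier tends to infinity. *)
Lemma below_barrier_near_0 (u : R -> R) (N B eps : R) :
  0 <= N -> 0 < eps -> 0 < B -> log_asymp_at_0 u (2 * N) ->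
  exists d, 0 < d < B /\ forall r, 0 < r <= d -> u r < barrier B eps r.
Proof.
  intros hN he hB [C [d hd]].
  (* [D] solves [eps * (ln B - ln D) = Rabs C + 1]. *)
  set (D := B * exp (- (Rabs C + 1) / eps)).
  assert (hC := Rabs_pos C); assert (hC' := Rle_abs C).
  assert (hDpos : 0 < D) by (apply Rmult_lt_0_compat; [lra | apply exp_pos]).
  assert (hd0 := cond_pos d).
  set (m := Rmin (Rmin (d / 2) (B / 2)) (Rmin 1 D)).
  assert (m <= d / 2) by (eapply Rle_trans; [apply Rmin_l | apply Rmin_l]).
  assert (m <= B / 2) by (eapply Rle_trans; [apply Rmin_l | apply Rmin_r]).
  assert (m <= 1) by (eapply Rle_trans; [apply Rmin_r | apply Rmin_l]).
  assert (m <= D) by (eapply Rle_trans; [apply Rmin_r | apply Rmin_r]).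
  assert (0 < m) by (repeat apply Rmin_glb_lt; lra).
  exists m; split; [lra|].
  intros r hr.
  assert (hu : Rabs (u r - 2 * N * ln r) <= C).
  { apply hd; [|lra]. change (Rabs (r - 0) < d). rewrite Rabs_right; lra. }
  apply Rabs_le_between in hu.
  assert (hlnle : forall x y, 0 < x -> x <= y -> ln x <= ln y).
  { intros x y hx [h | ->]; [left; now apply ln_increasing | lra]. }
  assert (hln : ln r <= 0) by (rewrite <- ln_1; apply hlnle; lra).
  assert (hlnD : ln r <= ln B + - (Rabs C + 1) / eps).
  { rewrite <- (ln_exp (- (Rabs C + 1) / eps)).
    rewrite <- ln_mult; [apply hlnle; fold D; lra | lra | apply exp_pos]. }
  assert (hmul : Rabs C + 1 <= eps * (ln B - ln r)).
  { replace (Rabs C + 1) with (eps * (- (- (Rabs C + 1) / eps))) by (field; lra).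
    apply Rmult_le_compat_l; lra. }
  assert (0 < 24 * (B * B) / ((B * B - r * r) * (B * B - r * r))) by
    (apply barrier_gt_main with (eps := eps); lra).
  unfold barrier. nra.
Qed.

Lemma below_barrier_near_edge (u v : R -> R) (B eps : R) :
  solves u v -> 0 < eps -> 0 < B ->
  exists b, 0 < b < B /\ forall r, b <= r < B -> u r < barrier B eps r.
Proof.
  intros hs he hB.
  destruct (continuity_ab_maj u (B / 2) B) as [p [hp _]].
  - lra.
  - intros x hx; apply (solves_continuous u v); [assumption | lra].
  - set (M := 1 + Rabs (u p)).
    assert (hM : 1 <= M) by (unfold M; assert (h := Rabs_pos (u p)); lra).
    (* For [B - eta <= r < B] this gives [B * B - r * r <= 2 * B * eta <= B / M], so the main term
       of the barrier is at least [24 * M ^ 2 > M]. *)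
    set (eta := Rmin (B / 2) (/ (2 * M))).
    assert (h1 : eta <= B / 2) by apply Rmin_l.
    assert (h2 : eta <= / (2 * M)) by apply Rmin_r.
    assert (h3 : 0 < eta) by
      (apply Rmin_glb_lt; [lra | apply Rinv_0_lt_compat; lra]).
    exists (B - eta); split; [lra|].
    intros r hr.
    assert (hur : u r <= u p) by (apply hp; lra).
    assert (hup : u p < M) by (unfold M; assert (h := Rle_abs (u p)); lra).
    destruct (barrier_gt_main B eps r ltac:(lra) he) as [_ h4].
    apply Rlt_trans with (2 := h4).
    apply Rle_lt_trans with (1 := hur), Rlt_trans with (1 := hup).
    assert (hsp : 0 < B * B - r * r) by nra.
    assert (hsM : (B * B - r * r) * M <= B).
    { apply Rle_trans with (2 * B * / (2 * M) * M); [|right; field; lra].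
      apply Rmult_le_compat_r; [lra|].
      apply Rle_trans with (2 * B * (B - r)); [nra|].
      apply Rmult_le_compat_l; lra. }
    apply Rmult_lt_reg_r with ((B * B - r * r) * (B * B - r * r)); [nra|].
    unfold Rdiv; rewrite Rmult_assoc, Rinv_l, Rmult_1_r by nra.
    assert ((B * B - r * r) <= (B * B - r * r) * M) by nra.
    assert ((B * B - r * r) * M * (B * B - r * r) <= B * B) by
      (apply Rmult_le_compat; nra).
    nra.
Qed.

(** The nonsmooth [max(u, v)] is avoided by maximizing [u - barrier] and [v - barrier] separately
    and applying the maximum principle to the one with the larger maximum. *)
Lemma below_barrier (u v : R -> R) (N1 N2 B eps r : R) :
  solves u v -> solves v u -> 0 <= N1 -> 0 <= N2 ->
  log_asymp_at_0 u (2 * N1) -> log_asymp_at_0 v (2 * N2) ->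
  0 < eps -> 0 < r < B -> u r <= barrier B eps r.
Proof.
  intros hu hv hN1 hN2 lu lv he hr.
  destruct (below_barrier_near_0 u N1 B eps) as [a1 [ha1 h1]]; try lra; auto.
  destruct (below_barrier_near_0 v N2 B eps) as [a2 [ha2 h2]]; try lra; auto.
  destruct (below_barrier_near_edge u v B eps) as [b1 [hb1 h3]]; try lra; auto.
  destruct (below_barrier_near_edge v u B eps) as [b2 [hb2 h4]]; try lra; auto.
  (* The interval contains [r], and both functions lie below the barrier at its ends. *)
  set (a := Rmin (Rmin a1 a2) r); set (b := Rmax (Rmax b1 b2) r).
  assert (a <= a1) by (eapply Rle_trans; [apply Rmin_l | apply Rmin_l]).
  assert (a <= a2) by (eapply Rle_trans; [apply Rmin_l | apply Rmin_r]).
  assert (a <= r) by apply Rmin_r.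
  assert (0 < a) by (repeat apply Rmin_glb_lt; lra).
  assert (b1 <= b) by (eapply Rle_trans; [apply Rmax_l | apply Rmax_l]).
  assert (b2 <= b) by (eapply Rle_trans; [apply Rmax_r | apply Rmax_l]).
  assert (r <= b) by apply Rmax_r.
  assert (b < B) by (repeat apply Rmax_lub_lt; lra).
  destruct (exists_max_diff_barrier u v B eps a b) as [p [hp hpm]]; try lra; auto.
  destruct (exists_max_diff_barrier v u B eps a b) as [q [hq hqm]]; try lra; auto.
  assert (hup := hpm r ltac:(lra)).
  (* At the point of the larger maximum the other function is no larger, as
     [no_contact_above_barrier] requires. *)
  destruct (Rle_or_lt (v q - barrier B eps q) (u p - barrier B eps p)) as [hle | hlt].
  - assert (u p <= barrier B eps p); [|lra].
    destruct (Req_dec p a) as [-> | hpa]; [left; apply h1; lra|].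
    destruct (Req_dec p b) as [-> | hpb]; [left; apply h3; lra|].
    apply (no_contact_above_barrier u v B eps a b p); auto; try lra.
    assert (h := hqm p hp); lra.
  - assert (v q <= barrier B eps q); [|lra].
    destruct (Req_dec q a) as [-> | hpa]; [left; apply h2; lra|].
    destruct (Req_dec q b) as [-> | hpb]; [left; apply h4; lra|].
    apply (no_contact_above_barrier v u B eps a b q); auto; try lra.
    assert (h := hpm q hq); lra.
Qed.

(** * Nonpositivity: removing the barrier *)

Lemma solution_nonpos (u v : R -> R) (N1 N2 r : R) :
  solves u v -> solves v u -> 0 <= N1 -> 0 <= N2 ->
  log_asymp_at_0 u (2 * N1) -> log_asymp_at_0 v (2 * N2) ->
  0 < r -> u r <= 0.
Proof.
  intros hu hv hN1 hN2 lu lv hr.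
  destruct (Rle_or_lt (u r) 0) as [h | hpos]; [exact h | exfalso].
  set (c := u r) in *.
  (* [B > 2 * r] makes the main term at most [24 * (16 / 9) / B ^ 2 < 43 / B ^ 2], which is below
     [c] since [B > 1] and [c * B > 43]. *)
  set (B := 1 + 2 * r + 43 / c).
  assert (hq : 0 < 43 / c) by (apply Rdiv_lt_0_compat; lra).
  assert (hB1 : 1 < B) by (unfold B; lra).
  assert (hBr : 2 * r < B) by (unfold B; lra).
  assert (hBc : 43 < c * B).
  { apply Rlt_le_trans with (c * (1 + 43 / c)).
    - replace (c * (1 + 43 / c)) with (c + 43) by (field; lra). lra.
    - apply Rmult_le_compat_l; unfold B; lra. }
  set (s := B * B - r * r).
  assert (hs : 3 * (B * B) <= 4 * s) by (unfold s; nra).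
  assert (hs0 : 0 < s) by nra.
  set (phi := 24 * (B * B) / (s * s)).
  assert (hphi : phi < c).
  { apply Rmult_lt_reg_r with (s * s); [nra|].
    unfold phi, Rdiv; rewrite Rmult_assoc, Rinv_l, Rmult_1_r by nra.
    assert (9 * (B * B) * (B * B) <= 16 * (s * s)) by nra.
    assert (43 * 1 < c * B * B) by nra.
    assert (43 * (B * B) < c * B * B * (B * B)) by nra.
    nra. }
  set (L := ln B - ln r).
  assert (hL : 0 < L) by
    (unfold L; assert (ln r < ln B) by (apply ln_increasing; lra); lra).
  (* This [eps] makes the logarithmic term half of the gap [c - phi]. *)
  assert (hb := below_barrier u v N1 N2 B ((c - phi) / (2 * L)) r hu hv hN1 hN2 lu lv
    ltac:(apply Rdiv_lt_0_compat; lra) ltac:(lra)).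
  unfold barrier in hb; fold s phi L c in hb.
  replace ((c - phi) / (2 * L) * L) with ((c - phi) / 2) in hb by (field; lra).
  lra.
Qed.

(** * Gronwall's inequality and uniqueness of the zero solution *)

Lemma nonincreasing_of_derive_nonpos (f f1 : R -> R) (x y : R) :
  x <= y -> (forall t, x <= t <= y -> is_derive f t (f1 t)) ->
  (forall t, x <= t <= y -> f1 t <= 0) -> f y <= f x.
Proof.
  intros [hxy | ->] hd hn; [|lra].
  destruct (MVT_cor2 f f1 x y hxy) as [c [he hc]].
  - intros t ht; now apply is_derive_Reals, hd.
  - assert (h := hn c ltac:(lra)); nra.
Qed.

Lemma Gronwall_zero (E E1 : R -> R) (a c K : R) :
  a <= c -> (forall t, a <= t -> is_derive E t (E1 t)) ->
  (forall t, a <= t -> 0 <= E t) ->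
  (forall t, a <= t -> Rabs (E1 t) <= K * E t) ->
  E c = 0 -> forall t, a <= t -> E t = 0.
Proof.
  intros hac hd h0 hK hc t ht.
  apply Rle_antisym; [|auto].
  (* [s] is the direction of travel from [c], so that one argument covers both sides. *)
  assert (hsign : forall s, (s = 1 \/ s = -1) -> 0 <= s * (t - c) -> E t <= 0).
  { intros s hs hst.
    (* [E(c + s x) exp(-K x)] is nonincreasing for [x >= 0]. *)
    assert (h : E (c + s * (s * (t - c))) * exp (- K * (s * (t - c)))
                <= E (c + s * 0) * exp (- K * 0)).
    { apply (nonincreasing_of_derive_nonpos
        (fun x => E (c + s * x) * exp (- K * x))
        (fun x => (s * E1 (c + s * x) - K * E (c + s * x)) * exp (- K * x)));
        [exact hst | |].
      - intros x hx.
        assert (hax : a <= c + s * x) by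
          (destruct hs as [-> | ->]; lra).
        assert (hdx := hd _ hax).
        auto_derive; [now exists (E1 (c + s * x))|].
        rewrite (is_derive_unique (fun y : R => E y) _ _ hdx); ring.
      - intros x hx.
        assert (hax : a <= c + s * x) by
          (destruct hs as [-> | ->]; lra).
        assert (hk := hK _ hax); apply Rabs_le_between in hk.
        assert (he := exp_pos (- K * x)).
        assert (s * E1 (c + s * x) - K * E (c + s * x) <= 0) by
          (destruct hs as [-> | ->]; lra).
        nra. }
    replace (c + s * 0) with c in h by ring.
    replace (c + s * (s * (t - c))) with t in h by
      (destruct hs as [-> | ->]; ring).
    rewrite hc, Rmult_0_l in h.
    assert (he := exp_pos (- K * (s * (t - c)))).
    nra. }
  destruct (Rle_or_lt c t).
  - apply (hsign 1); [auto | lra].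
  - apply (hsign (-1)); [auto | lra].
Qed.

Lemma zero_solution_unique (u v : R -> R) (c : R) :
  solves u v -> solves v u ->
  (forall r, 0 < r -> u r <= 0) -> (forall r, 0 < r -> v r <= 0) ->
  0 < c -> u c = 0 -> v c = 0 -> Derive u c = 0 -> Derive v c = 0 ->
  forall r, 0 < r -> u r = 0 /\ v r = 0.
Proof.
  intros hu hv nu nv hc uc vc duc dvc r hr.
  (* The squared norm in phase space. Staying on [t >= a] keeps the coefficient [/ t] bounded. *)
  set (E := fun t => u t ^ 2 + v t ^ 2 + Derive u t ^ 2 + Derive v t ^ 2).
  set (a := Rmin r c).
  assert (har : a <= r) by apply Rmin_l.
  assert (hac : a <= c) by apply Rmin_r.
  assert (ha : 0 < a) by (apply Rmin_glb_lt; lra).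
  assert (hE : E r = 0).
  { apply (Gronwall_zero E
      (fun t => 2 * u t * Derive u t + 2 * v t * Derive v t
        + 2 * Derive u t * Derive (Derive u) t
        (* The products and the Lipschitz bound on [F] contribute at most [13 * E], so 40 is
           generous; the first-order term contributes [2 / a]. *)
        + 2 * Derive v t * Derive (Derive v) t) a c (40 + 2 / a)); auto.
    - intros t ht.
      destruct (hu t ltac:(lra)) as [[h1 h2] _].
      destruct (hv t ltac:(lra)) as [[h3 h4] _].
      unfold E; auto_derive; [repeat split; auto | ].
      change (Derive (fun x => Derive u x) t) with (Derive (Derive u) t).
      change (Derive (fun x => Derive v x) t) with (Derive (Derive v) t).
      change (Derive (fun x => u x) t) with (Derive u t).
      change (Derive (fun x => v x) t) with (Derive v t).
      ring.
    - intros t _; unfold E; nra.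
    - intros t ht; unfold E.
      destruct (hu t ltac:(lra)) as [_ h1].
      destruct (hv t ltac:(lra)) as [_ h2].
      assert (b1 := F_Lipschitz_nonpos (u t) (v t) (nu t ltac:(lra)) (nv t ltac:(lra))).
      assert (b2 := F_Lipschitz_nonpos (v t) (u t) (nv t ltac:(lra)) (nu t ltac:(lra))).
      unfold radial_laplacian in h1, h2.
      assert (hia : / t <= / a) by (apply Rinv_le_contravar; lra).
      assert (hit : 0 < / t) by (apply Rinv_0_lt_compat; lra).
      unfold Rdiv.
      replace (Derive (Derive u) t) with (F (u t) (v t) - / t * Derive u t) by lra.
      replace (Derive (Derive v) t) with (F (v t) (u t) - / t * Derive v t) by lra.
      generalize dependent (F (u t) (v t)); intros f _ b1.
      generalize dependent (F (v t) (u t)); intros g _ b2.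
      set (p := Derive u t); set (q := Derive v t).
      generalize dependent (u t); intros x b1 b2.
      generalize dependent (v t); intros y b1 b2.
      assert (hprod : forall s w, 2 * Rabs (s * w) <= s ^ 2 + w ^ 2).
      { intros s w; rewrite Rabs_mult, <- (pow2_abs s), <- (pow2_abs w).
        assert (h := pow2_ge_0 (Rabs s - Rabs w)); nra. }
      assert (hF : forall s w, Rabs w <= 6 * (Rabs x + Rabs y) ->
        2 * Rabs (s * w) <= 12 * s ^ 2 + 6 * x ^ 2 + 6 * y ^ 2).
      { intros s w hw.
        assert (h1' := hprod s x); assert (h2' := hprod s y).
        rewrite Rabs_mult in *.
        assert (h3 := Rabs_pos s); nra. }
      assert (e1 := hprod x p); assert (e2 := hprod y q).
      assert (e3 := hF p f b1).
      assert (e4 := hF q g ltac:(lra)).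
      assert (e5 : / t * (p ^ 2 + q ^ 2) <= / a * (p ^ 2 + q ^ 2)) by
        (apply Rmult_le_compat_r; nra).
      assert (e6 : 0 <= / t * (p ^ 2 + q ^ 2)) by (apply Rmult_le_pos; nra).
      assert (e7 : 0 <= / a * (x ^ 2 + y ^ 2)) by (apply Rmult_le_pos; nra).
      assert (hb : forall z, - Rabs z <= z <= Rabs z) by
        (intros z; apply Rabs_le_between; lra).
      assert (j1 := hb (x * p)); assert (j2 := hb (y * q)).
      assert (j3 := hb (p * f)); assert (j4 := hb (q * g)).
      assert (k1 := pow2_ge_0 x); assert (k2 := pow2_ge_0 y).
      assert (k3 := pow2_ge_0 p); assert (k4 := pow2_ge_0 q).
      replace (2 * x * p + 2 * y * q + 2 * p * (f - / t * p) + 2 * q * (g - / t * q))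
        with (2 * (x * p) + 2 * (y * q) + 2 * (p * f) + 2 * (q * g)
              - 2 * (/ t * (p ^ 2 + q ^ 2))) by ring.
      replace ((40 + 2 * / a) * (x ^ 2 + y ^ 2 + p ^ 2 + q ^ 2))
        with (40 * x ^ 2 + 40 * y ^ 2 + 40 * p ^ 2 + 40 * q ^ 2
          + 2 * (/ a * (x ^ 2 + y ^ 2)) + 2 * (/ a * (p ^ 2 + q ^ 2))) by ring.
      apply Rabs_le; split; lra.
    - unfold E; rewrite uc, vc, duc, dvc; ring. }
  unfold E in hE.
  assert (k1 := pow2_ge_0 (u r)); assert (k2 := pow2_ge_0 (v r)).
  assert (k3 := pow2_ge_0 (Derive u r)); assert (k4 := pow2_ge_0 (Derive v r)).
  split; nra.
Qed.

(** * Zeros of nonpositive solutions and the dichotomy *)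

Lemma laplacian_at_zero (u v : R -> R) (c : R) :
  solves u v -> (forall r, 0 < r -> u r <= 0) -> 0 < c -> u c = 0 ->
  Derive u c = 0 /\ F (u c) (v c) <= 0.
Proof.
  intros hu nu hc uc.
  destruct (laplacian_at_max u (fun _ => 0) (fun _ => 0) 0 (2 * c) c 0) as [h1 h2].
  - lra.
  - intros x hx; apply hu; lra.
  - intros x _; apply (is_derive_const (V := R_NormedModule)).
  - apply (is_derive_const (V := R_NormedModule)).
  - intros x hx; rewrite uc; assert (h := nu x ltac:(lra)); lra.
  - split; [exact h1|].
    rewrite <- (proj2 (hu c hc)); lra.
Qed.

Lemma vanishing_of_zero (u v : R -> R) (c : R) :
  solves u v -> solves v u ->
  (forall r, 0 < r -> u r <= 0) -> (forall r, 0 < r -> v r <= 0) ->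
  0 < c -> u c = 0 -> forall r, 0 < r -> u r = 0 /\ v r = 0.
Proof.
  intros hu hv nu nv hc uc.
  destruct (laplacian_at_zero u v c hu nu hc uc) as [duc hF].
  (* With [u c = 0] and [V = exp (v c)], the sign condition reads [2 - 2 * V ^ 2 <= 0], which
     excludes [V < 1]. *)
  assert (vc : v c = 0).
  { unfold F in hF; rewrite uc, !exp_double, exp_plus, exp_0 in hF.
    assert (hV := exp_pos (v c)).
    apply Rle_antisym; [auto|].
    destruct (Rle_or_lt 0 (v c)) as [h | hneg]; [exact h|].
    assert (exp (v c) < 1) by (rewrite <- exp_0; now apply exp_increasing).
    nra. }
  destruct (laplacian_at_zero v u c hv nv hc vc) as [dvc _].
  apply (zero_solution_unique u v c); auto.
Qed.

Theorem theorem1p1 (N1 N2 : R) (u v : R -> R)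
    (hN1 : 0 <= N1) (hN2 : 0 <= N2)
    (huv : entire_radial_solution N1 N2 u v) :
  (forall r : R, 0 < r -> u r < 0 /\ v r < 0) \/
  (forall r : R, 0 < r -> u r = 0 /\ v r = 0).
Proof.
  destruct huv as [heq [[lu _] [lv _]]].
  assert (hu : solves u v).
  { intros r hr; destruct (heq r hr) as (h1 & _ & h3 & _); split; [exact h1|].
    rewrite h3; unfold F; ring. }
  assert (hv : solves v u).
  { intros r hr; destruct (heq r hr) as (_ & h2 & _ & h4); split; [exact h2|].
    rewrite h4; unfold F; rewrite (Rplus_comm (v r)); ring. }
  assert (nu : forall r, 0 < r -> u r <= 0) by
    (intros r hr; now apply (solution_nonpos u v N1 N2)).
  assert (nv : forall r, 0 < r -> v r <= 0) by
    (intros r hr; now apply (solution_nonpos v u N2 N1)).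
  destruct (classic (exists c, 0 < c /\ (u c = 0 \/ v c = 0)))
    as [[c [hc [h | h]]] | hno].
  - right; now apply (vanishing_of_zero u v c).
  - right; intros r hr.
    destruct (vanishing_of_zero v u c hv hu nv nu hc h r hr); auto.
  - left; intros r hr; split.
    + destruct (nu r hr) as [h | h]; [exact h|].
      exfalso; apply hno; exists r; auto.
    + destruct (nv r hr) as [h | h]; [exact h|].
      exfalso; apply hno; exists r; auto.
Qed.
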